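(* Let $\{\Omega^*(\lambda_i) : i=0,1,\dots,k\}$ be a solution path generated by the adaptive sieving reduction algorithm (defined in the context) with input matrix $A\in\mathbb R^{p\times n}$, tolerance $\epsilon\ge0$, and regularization parameters $\lambda_0>\lambda_1>\dots>\lambda_k>0$. Then the $\Omega^*(\lambda_i)$ are approximate optimal solutions of the problems $$\min_{\Omega\in\mathbb S^p}\Bigl\{\tfrac12\|\Omega A\|_F^2-\langle\Omega,I_p\rangle+\lambda_i\|\Omega\|_{1,\mathrm{off}}\Bigr\},\qquad i=0,1,\dots,k,$$ in the sense that $\|R_{\lambda_i}(\Omega^*(\lambda_i))\|_F\le\epsilon$ for every $i=0,1,\dots,k$.
   Context: $\mathbb S^p$ is the space of real symmetric $p\times p$ matrices with $\langle X,Y\rangle=\mathrm{tr}(X^TY)$ and Frobenius norm $\|\cdot\|_F$; $I_p$ is the identity. $A\in\mathbb R^{p\times n}$ has rank $n$ and $\widehat\Sigma=AA^T$. $\theta(\Omega)=\|\Omega\|_{1,\mathrm{off}}=\sum_{i\ne j}|\Omega_{ij}|$. $h(\Omega)=\frac12(\Omega\widehat\Sigma+\widehat\Sigma\Omega)-I_p$ (the gradient on $\mathbb S^p$ of $\frac12\|\Omega A\|_F^2-\langle\Omega,I_p\rangle$). For a closed proper convex $f$, $\mathrm{Prox}_f(X)=\mathrm{argmin}_Y\{f(Y)+\frac12\|Y-X\|_F^2\}$. For $\lambda>0$, let $B_\lambda=\{Z\in\mathbb S^p: Z_{ii}=0,\ |Z_{ij}|\le\lambda\ (i\ne j)\}$,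 $\delta_{B_\lambda}$ its indicator function, and the proximal residual mapping $$R_\lambda(\Omega)=h(\Omega)+\mathrm{Prox}_{\delta_{B_\lambda}}(\Omega-h(\Omega))\ \bigl(=\Omega-\mathrm{Prox}_{\lambda\theta}(\Omega-h(\Omega))\bigr).$$ A matrix $\Omega$ is an optimal solution of $\min_{\Omega\in\mathbb S^p}\{\frac12\|\Omega A\|_F^2-\langle\Omega,I_p\rangle+\lambda\|\Omega\|_{1,\mathrm{off}}\}$ iff $R_\lambda(\Omega)=0$. $\mathbb B_\infty$ is the unit ball of the entrywise infinity norm; $\bar I$ denotes the complement of an index set $I\subseteq\{1,\dots,p\}^2$. Adaptive sieving reduction algorithm. Input: $A$, $\epsilon\ge0$, $\lambda_{\max}\ge\lambda_0>\lambda_1>\dots>\lambda_k>0$, where $\lambda_{\max}=\max_{i<j}\frac12|\widehat\Sigma_{ij}/\widehat\Sigma_{ii}+\widehat\Sigma_{ij}/\widehat\Sigma_{jj}|$. Initialization: take $$\Omega^*(\lambda_0)\in\mathrm{argmin}_{\Omega\in\mathbb S^p}\Bigl\{\tfrac12\|\Omega A\|_F^2-\langle\Omega,I_p\rangle+\lambda_0\|\Omega\|_{1,\mathrm{off}}-\langle\Delta_0,\Omega\rangle\Bigr\}$$ for some $\Delta_0\in\mathbb S^p$ with $\|\Delta_0\|_F\le\epsilon$, and $I^*(\lambda_0)=\{(a,b):\Omega^*(\lambda_0)_{ab}\ne0\}$. For $i=1,\dots,k$: set $\Omega^0(\lambda_i)=\Omega^*(\lambda_{i-1})$, $I^0(\lambda_i)=I^*(\lambda_{i-1})$,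 $l=0$. While $\|R_{\lambda_i}(\Omega^l(\lambda_i))\|_F>\epsilon$ do: (i) $l\leftarrow l+1$; (ii) let $J^l(\lambda_i)$ be the set of all $(a,b)\in\bar I^{\,l-1}(\lambda_i)$ such that $$-\bigl(h(\Omega^{l-1}(\lambda_i))\bigr)_{ab}\notin\lambda_i\Bigl(\partial\theta(\Omega^{l-1}(\lambda_i))+\frac{\epsilon}{\lambda_i\sqrt{2|\bar I^{\,l-1}(\lambda_i)|}}\,\mathbb B_\infty\Bigr)_{ab};$$ (iii) $I^l(\lambda_i)=I^{l-1}(\lambda_i)\cup J^l(\lambda_i)$; (iv) take $$\Omega^l(\lambda_i)\in\mathrm{argmin}_{\Omega\in\mathbb S^p}\Bigl\{\tfrac12\|\Omega A\|_F^2-\langle\Omega,I_p\rangle+\lambda_i\|\Omega\|_{1,\mathrm{off}}-\langle\Delta_i^l,\Omega\rangle\ \Big|\ \Omega_{\bar I^{\,l}(\lambda_i)}=0\Bigr\}$$ for some $\Delta_i^l\in\mathbb S^p$ with $\|\Delta_i^l\|_F\le\epsilon/\sqrt2$ and $(\Delta_i^l)_{\bar I^{\,l}(\lambda_i)}=0$. When the while loop ends, set $\Omega^*(\lambda_i)=\Omega^l(\lambda_i)$ and $I^*(\lambda_i)=I^l(\lambda_i)$. (The matrices $\Delta_0,\Delta_i^l$ are not prescribed; they represent the inexactness with which the minimization problems are solved.) Output: $\Omega^*(\lambda_0),\dots,\Omega^*(\lambda_k)$. *)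

(* Defs.v *)
From HB Require Import structures.
From mathcomp Require Import all_boot all_order all_algebra.
From mathcomp Require Import boolp classical_sets reals constructive_ereal.

Set Implicit Arguments.
Unset Strict Implicit.
Unset Printing Implicit Defensive.

Import Order.TTheory GRing.Theory Num.Theory.

Local Open Scope ring_scope.
Local Open Scope classical_set_scope.

Definition argmin {disp : Order.disp_t} {T : porderType disp} {M : Type}
    (D : set M) (f : M -> T) : set M :=
  [set x | D x /\ forall y, D y -> (f x <= f y)%O].

Section Matrices.
Context {R : realType}.

Definition frob_dot m n (X Y : 'M[R]_(m, n)) : R := \tr (X^T *m Y).

Definition frob_norm m n (X : 'M[R]_(m, n)) : R := Num.sqrt (frob_dot X X).

Context {p : nat}.
Implicit Types X Y Z G E Om : 'M[R]_p.

Definition Sym : set 'M[R]_p := [set X | X^T = X].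

Definition subdiff (f : 'M[R]_p -> R) X : set 'M[R]_p :=
  [set G | Sym G /\
     forall Y, Sym Y -> f X + frob_dot G (Y - X) <= f Y].

(* The default value 0 is returned only if the argmin is empty, which does not
   happen for a closed proper convex f. *)
Definition prox (f : 'M[R]_p -> \bar R) X : 'M[R]_p :=
  xget 0 (argmin Sym
    (fun Y => (f Y + (2^-1 * frob_norm (Y - X) ^+ 2)%:E)%E)).

Definition indicator (B : set 'M[R]_p) Z : \bar R :=
  if `[< B Z >] then 0%E else +oo%E.

Definition theta Om : R :=
  \sum_(ij : 'I_p * 'I_p | ij.1 != ij.2) `|Om ij.1 ij.2|.

Definition Blam (lam : R) : set 'M[R]_p :=
  [set Z | [/\ Sym Z, forall i, Z i i = 0
             & forall i j, i != j -> `|Z i j| <= lam]].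

Definition Binf : set 'M[R]_p :=
  [set E | Sym E /\ forall i j, `|E i j| <= 1].

Context {n : nat}.
Implicit Type A : 'M[R]_(p, n).

Definition Sigmahat A : 'M[R]_p := A *m A^T.

Definition h A Om : 'M[R]_p :=
  2^-1 *: (Om *m Sigmahat A + Sigmahat A *m Om) - 1%:M.

Definition resid A (lam : R) Om : 'M[R]_p :=
  h A Om + prox (indicator (Blam lam)) (Om - h A Om).

(* The perturbation Delta accounts for inexact minimization. *)
Definition objective A (lam : R) (Delta : 'M[R]_p) Om : R :=
  2^-1 * frob_norm (Om *m A) ^+ 2 - frob_dot Om 1%:M + lam * theta Om
  - frob_dot Delta Om.

Definition lambda_max A : R :=
  let S := Sigmahat A in
  \big[Num.max/0]_(ij : 'I_p * 'I_p | (ij.1 < ij.2)%N)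
    (2^-1 * `|S ij.1 ij.2 / S ij.1 ij.1 + S ij.1 ij.2 / S ij.2 ij.2|).

Definition supp_mx Om : {set 'I_p * 'I_p} :=
  [set ab : 'I_p * 'I_p | Om ab.1 ab.2 != 0]%SET.

Definition zero_on (K : {set 'I_p * 'I_p}) : set 'M[R]_p :=
  [set X | forall a b, (a, b) \in K -> X a b = 0].

Definition inflated_subdiff (lam c : R) Om : set 'M[R]_p :=
  [set X | exists G E,
     [/\ subdiff theta Om G, Binf E & X = lam *: (G + c *: E)]].

(* For a set S of matrices, S_ab denotes the set of (a,b) entries of its
   elements. If ~: I is empty, the radius below is a division by 0, but then
   no index is tested. *)
Definition sieve A (eps lam : R) Om (I : {set 'I_p * 'I_p}) :
    {set 'I_p * 'I_p} :=
  let c := eps / (lam * Num.sqrt (2 * #|~: I|%:R)) in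
  [set ab in ~: I |
     `[< ~ [set X ab.1 ab.2 | X in inflated_subdiff lam c Om]%classic
             (- h A Om ab.1 ab.2) >]]%SET.

Definition as_init A (eps lam0 : R) Om (I : {set 'I_p * 'I_p}) : Prop :=
  (exists Delta, [/\ Sym Delta, frob_norm Delta <= eps
     & argmin Sym (objective A lam0 Delta) Om])
  /\ I = supp_mx Om.

Definition as_step A (eps lam : R) Om (I : {set 'I_p * 'I_p})
    Om' (I' : {set 'I_p * 'I_p}) : Prop :=
  I' = (I :|: sieve A eps lam Om I)%SET /\
  exists Delta, [/\ Sym Delta, frob_norm Delta <= eps / Num.sqrt 2,
      zero_on (~: I')%SET Delta
    & argmin (Sym `&` zero_on (~: I')%SET) (objective A lam Delta) Om'].

(* Big-step semantics of the while loop: [as_loop A eps lam Om I Om' I'] means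
   that some execution started at (Om, I) terminates at (Om', I'). *)
Inductive as_loop A (eps lam : R) :
    'M[R]_p -> {set 'I_p * 'I_p} -> 'M[R]_p -> {set 'I_p * 'I_p} -> Prop :=
| as_loop_exit Om I :
    ~~ (frob_norm (resid A lam Om) > eps) -> as_loop A eps lam Om I Om I
| as_loop_iter Om I Om1 I1 Om2 I2 :
    frob_norm (resid A lam Om) > eps ->
    as_step A eps lam Om I Om1 I1 ->
    as_loop A eps lam Om1 I1 Om2 I2 ->
    as_loop A eps lam Om I Om2 I2.

(* Only the values of lam and Omega at 0, ..., k are relevant. *)
Definition as_path A (eps : R) (k : nat) (lam : nat -> R)
    (Omega : nat -> 'M[R]_p) : Prop :=
  exists I : nat -> {set 'I_p * 'I_p},
    as_init A eps (lam 0%N) (Omega 0%N) (I 0%N) /\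
    forall i, (i < k)%N ->
      as_loop A eps (lam i.+1) (Omega i) (I i) (Omega i.+1) (I i.+1).

End Matrices.

(* Main.v *)
(** For [i >= 1] the bound is the exit condition of the while loop. For [i = 0],
    optimality of [Om] makes [Z := Delta - h A Om] a subgradient of
    [lam * theta] at [Om]. Since the projection onto [Blam lam] is entrywise
    clipping, this forces [Z] to be the projection of [Om + Z], and the residual
    becomes [Delta - (P (Om + Z) - P (Om + Z - Delta))], each entry of which is
    dominated by that of [Delta]. *)

Require Import Defs.
From mathcomp Require Import all_boot all_order all_algebra.
From mathcomp Require Import boolp classical_sets reals constructive_ereal.
From mathcomp Require Import ring lra.

Import Order.TTheory GRing.Theory Num.Theory.
Local Open Scope ring_scope.

(** * The Frobenius inner product and norm *)

Section FrobeniusProduct.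
Set Implicit Arguments.
Unset Strict Implicit.
Context {R : realType}.

Lemma frob_dotE m n (X Y : 'M[R]_(m, n)) :
  frob_dot X Y = \sum_i \sum_j X i j * Y i j.
Proof.
rewrite /frob_dot /mxtrace exchange_big /=; apply: eq_bigr => j _.
by rewrite mxE; apply: eq_bigr => i _; rewrite mxE.
Qed.

Lemma frob_dotC m n (X Y : 'M[R]_(m, n)) : frob_dot X Y = frob_dot Y X.
Proof.
rewrite !frob_dotE; apply: eq_bigr => i _; apply: eq_bigr => j _.
exact: mulrC.
Qed.

Lemma frob_dotDr m n (X Y Z : 'M[R]_(m, n)) :
  frob_dot X (Y + Z) = frob_dot X Y + frob_dot X Z.
Proof. by rewrite /frob_dot mulmxDr mxtraceD. Qed.

Lemma frob_dotZr m n (X Y : 'M[R]_(m, n)) a :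
  frob_dot X (a *: Y) = a * frob_dot X Y.
Proof. by rewrite /frob_dot -scalemxAr mxtraceZ. Qed.

Lemma frob_dotDl m n (X Y Z : 'M[R]_(m, n)) :
  frob_dot (X + Y) Z = frob_dot X Z + frob_dot Y Z.
Proof. by rewrite !(frob_dotC _ Z) frob_dotDr. Qed.

Lemma frob_dotZl m n (X Y : 'M[R]_(m, n)) a :
  frob_dot (a *: X) Y = a * frob_dot X Y.
Proof. by rewrite !(frob_dotC _ Y) frob_dotZr. Qed.

Lemma frob_dotNl m n (X Y : 'M[R]_(m, n)) :
  frob_dot (- X) Y = - frob_dot X Y.
Proof. by rewrite -scaleN1r frob_dotZl mulN1r. Qed.

Lemma frob_dot_ge0 m n (X : 'M[R]_(m, n)) : 0 <= frob_dot X X.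
Proof.
by rewrite frob_dotE; do 2!(apply: sumr_ge0 => ? _); rewrite -expr2 sqr_ge0.
Qed.

Lemma frob_norm_sqr m n (X : 'M[R]_(m, n)) : frob_norm X ^+ 2 = frob_dot X X.
Proof. by rewrite sqr_sqrtr ?frob_dot_ge0. Qed.

Lemma frob_dot_eq0 m n (X : 'M[R]_(m, n)) : frob_dot X X <= 0 -> X = 0.
Proof.
rewrite frob_dotE => XX_le0; apply/matrixP => i j; rewrite mxE.
have sq_ge0 i' j' : 0 <= X i' j' * X i' j' by rewrite -expr2 sqr_ge0.
(* An entry vanishes iff its square does, and that square is at most the whole sum of squares. *)
apply/eqP; rewrite -[_ == 0]orbb -mulf_eq0 eq_le sq_ge0 andbT.
apply: le_trans XX_le0.
rewrite (bigD1 i) //= (bigD1 j) //= -addrA lerDl addr_ge0 //.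
  by apply: sumr_ge0.
by apply: sumr_ge0 => i' _; apply: sumr_ge0.
Qed.

Lemma le_frob_norm m n (X Y : 'M[R]_(m, n)) :
  (forall i j, `|X i j| <= `|Y i j|) -> frob_norm X <= frob_norm Y.
Proof.
move=> leXY; rewrite /frob_norm ler_wsqrtr // !frob_dotE.
apply: ler_sum => i _; apply: ler_sum => j _.
by rewrite -!expr2 -(real_normK (num_real (X i j))) -(real_normK (num_real (Y i j)))
  lerXn2r ?nnegrE.
Qed.

End FrobeniusProduct.

(** * First-order optimality conditions *)

Section Optimality.
Set Implicit Arguments.
Unset Strict Implicit.
Context {R : realType} {p n : nat}.
Implicit Types (A : 'M[R]_(p, n)) (X Y Z D Om Delta : 'M[R]_p).

Lemma h_sym A Om : Sym Om -> Sym (h A Om).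
Proof.
move=> symOm; rewrite /Sym /h /=.
have : (Sigmahat A)^T = Sigmahat A by rewrite /Sigmahat trmx_mul trmxK.
move: (Sigmahat A) => S symS.
by rewrite linearB linearZ linearD /= trmx1 !trmx_mul symOm symS [X in _ *: X]addrC.
Qed.

(** By symmetry and cyclicity of the trace, the two products in [h] contribute equally. The
    right-hand side is the derivative of the smooth part of the objective at [Om] along [D]. *)
Lemma frob_dot_h A Om D : Sym Om -> Sym D ->
  frob_dot (h A Om) D = frob_dot (Om *m A) (D *m A) - frob_dot D 1%:M.
Proof.
rewrite /Sym /= => symOm symD.
rewrite /h frob_dotDl frob_dotNl frob_dotZl frob_dotDl (frob_dotC 1%:M).
congr (_ - _).
have -> : frob_dot (Om *m Sigmahat A) D = frob_dot (Om *m A) (D *m A).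
  rewrite /frob_dot /Sigmahat !trmx_mul trmxK symOm.
  by rewrite -!mulmxA mxtrace_mulC -!mulmxA.
have -> : frob_dot (Sigmahat A *m Om) D = frob_dot (Om *m A) (D *m A).
  rewrite [RHS]frob_dotC /frob_dot /Sigmahat !trmx_mul trmxK symOm symD.
  by rewrite -!mulmxA mxtrace_mulC -!mulmxA mxtrace_mulC -!mulmxA.
by field.
Qed.

(** The smooth part is quadratic, so its second-order expansion is exact. *)
Lemma objective_line A lam Delta Om D (s : R) : Sym Om -> Sym D ->
  objective A lam Delta (Om + s *: D) =
  objective A lam Delta Om + s * frob_dot (h A Om - Delta) D
  + s ^+ 2 * (2^-1 * frob_norm (D *m A) ^+ 2)
  + lam * (theta (Om + s *: D) - theta Om).
Proof.
move=> symOm symD; rewrite /objective !frob_norm_sqr [frob_dot (h _ _ - _) _]frob_dotDl.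
rewrite frob_dotNl frob_dot_h // mulmxDl -scalemxAl !(frob_dotDl, frob_dotDr).
rewrite !(frob_dotZl, frob_dotZr) (frob_dotC (D *m A) (Om *m A)).
by field.
Qed.

Lemma theta_line Om D (s : R) : 0 <= s <= 1 ->
  theta (Om + s *: D) - theta Om <= s * (theta (Om + D) - theta Om).
Proof.
move=> /andP[s_ge0 s_le1]; rewrite /theta -!sumrB mulr_sumr.
apply: ler_sum => -[i j] _ /=; rewrite !mxE.
set x := Om i j; set d := D i j.
have -> : x + s * d = (1 - s) * x + s * (x + d) by ring.
have := ler_normD ((1 - s) * x) (s * (x + d)).
rewrite !normrM (ger0_norm s_ge0) (_ : `|1 - s| = 1 - s); last first.
  by rewrite ger0_norm // subr_ge0.
by lra.
Qed.

(** Along the segment from [Om] to [Y] the objective grows by at most [s * (t + b) + s ^+ 2 * q], by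
    convexity of [theta]. If [t + b] were negative, a small [s] would contradict minimality. *)
Lemma argmin_subgradient A lam Delta Om Y : 0 <= lam -> Sym Delta ->
  argmin Sym (objective A lam Delta) Om -> Sym Y ->
  frob_dot (Delta - h A Om) (Y - Om) <= lam * (theta Y - theta Om).
Proof.
move=> lam_ge0 symDelta [symOm minOm] symY.
have symD : Sym (Y - Om) by rewrite /Sym /= linearB /= symY symOm.
rewrite -(opprB (h A Om)) frob_dotNl -subr_ge0 opprK leNgt.
set D := Y - Om in symD *; set t := lam * _; set b := frob_dot _ _.
apply/negP => a_lt0.
pose q := 2^-1 * frob_norm (D *m A) ^+ 2.
have q_ge0 : 0 <= q by rewrite mulr_ge0 ?sqr_ge0 // invr_ge0.
(* An explicit step in place of a limit: its denominator is positive even if [q = 0], it lies in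
   [(0, 1]], and it keeps [t + b + s * q] negative. *)
pose s := - (t + b) / (q - (t + b)).
have qa_gt0 : 0 < q - (t + b) by lra.
have s_gt0 : 0 < s by rewrite divr_gt0 //; lra.
have s_le1 : s <= 1 by rewrite ler_pdivrMr //; lra.
have symL : Sym (Om + s *: D).
  by rewrite /Sym /= linearD linearZ /= symOm symD.
have := minOm _ symL; rewrite objective_line // -/q -/b.
have s01 : 0 <= s <= 1 by rewrite ltW.
have := ler_wpM2l lam_ge0 (theta_line Om D s01).
rewrite [Om + D]addrC subrK mulrCA -/t => le_t le_obj.
have {le_t le_obj} : 0 <= s * (t + b + s * q).
  by move: le_t le_obj; rewrite expr2; lra.
rewrite pmulr_rge0 // leNgt => /negP; apply.
have -> : t + b + s * q = - ((t + b) ^+ 2 / (q - (t + b))).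
  by rewrite /s; field; lra.
by rewrite oppr_lt0 divr_gt0 // exprn_even_gt0 //= lt_eqF.
Qed.

(** Only symmetric test matrices are allowed, so [t] is added at [(i, j)] and at [(j, i)] together.
    By symmetry both positions contribute the same amount [g]; the factor [(i != j)%:R] reflects
    that [theta] ignores the diagonal. *)
Lemma subgradient_entry lam Z Om i j (t : R) : Sym Z -> Sym Om ->
  (forall Y, Sym Y -> frob_dot Z (Y - Om) <= lam * (theta Y - theta Om)) ->
  Z i j * t <= (i != j)%:R * (lam * (`|Om i j + t| - `|Om i j|)).
Proof.
move=> symZ symOm subg.
have Zs a b : Z a b = Z b a by rewrite -{1}symZ mxE.
have Os a b : Om a b = Om b a by rewrite -{1}symOm mxE.
pose S : {set 'I_p * 'I_p} := [set (i, j); (j, i)]%SET.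
pose Y : 'M[R]_p := \matrix_(a, b) (Om a b + ((a, b) \in S)%:R * t).
have SC a b : ((a, b) \in S) = ((b, a) \in S).
  by rewrite !inE !xpair_eqE orbC andbC [X in _ || X]andbC.
have symY : Sym Y by apply/matrixP => a b; rewrite !mxE Os SC.
have := subg _ symY; rewrite -subr_ge0 frob_dotE /theta -sumrB mulr_sumr.
rewrite [X in X - _]big_mkcond /= pair_bigA /= -sumrB.
pose g := (i != j)%:R * (lam * (`|Om i j + t| - `|Om i j|)) - Z i j * t.
rewrite (eq_bigr (fun ab => if ab \in S then g else 0)); last first.
  case=> a b _ /=; rewrite !mxE [_ + _ - Om a b]addrC addKr.
  case: ifP => abS; case: ifP => abS'; rewrite ?mul1r ?mul0r ?addr0 ?subrr ?mulr0 ?subr0 //.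
    move: abS abS'; rewrite !inE !xpair_eqE => ne.
    case/orP=> /andP[/eqP ea /eqP eb]; rewrite /g; subst.
      by rewrite ne mul1r.
    by rewrite eq_sym ne mul1r Zs Os.
  move: abS abS'; rewrite !inE !xpair_eqE => ne.
  case/orP=> /andP[/eqP ea /eqP eb]; rewrite /g; subst.
    by rewrite ne mul0r.
  by rewrite eq_sym ne mul0r Zs.
(* The sum is [g] times [#|S|], which is 1 on the diagonal and 2 off it; positivity covers both
   cases. *)
rewrite -big_mkcond /= sumr_const pmulrn_lge0 ?subr_ge0 //.
by apply/card_gt0P; exists (i, j); rewrite !inE eqxx.
Qed.

End Optimality.

(** * Projection onto [Blam lam] and the residual bound *)

Section Projection.
Set Implicit Arguments.
Unset Strict Implicit.
Context {R : realType} {p : nat}.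
Implicit Types (X Y : 'M[R]_p).

Definition clip (lam x : R) : R := Num.max (- lam) (Num.min lam x).

Lemma clipP (lam x : R) : 0 <= lam ->
  [\/ x <= - lam /\ clip lam x = - lam,
      - lam <= x <= lam /\ clip lam x = x
    | lam <= x /\ clip lam x = lam].
Proof.
move=> lam_ge0; rewrite /clip.
have [le_lx|lt_xl] := leP lam x.
  by apply: Or33; split=> //; apply/max_idPr; lra.
have [le_xl|lt_lx] := leP x (- lam); first by apply: Or31.
by apply: Or32; split=> //; lra.
Qed.

(** This is the variational inequality of the projection onto [[-lam, lam]]. *)
Lemma clip_obtuse (lam x y : R) : 0 <= lam -> `|y| <= lam ->
  0 <= (clip lam x - x) * (y - clip lam x).
Proof.
move=> lam_ge0; rewrite ler_norml => /andP[y1 y2].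
by case: (clipP x lam_ge0) => -[hx ->]; nra.
Qed.

Definition Blam_proj (lam : R) X : 'M[R]_p :=
  \matrix_(i, j) ((i != j)%:R * clip lam (X i j)).

Lemma Blam_proj_in (lam : R) X : 0 <= lam -> Sym X -> Blam lam (Blam_proj lam X).
Proof.
move=> lam_ge0 symX; split=> [|i|i j neq_ij].
- by apply/matrixP => i j; rewrite !mxE eq_sym -{1}symX mxE.
- by rewrite mxE eqxx mul0r.
- rewrite mxE neq_ij mul1r ler_norml.
  by case: (clipP (X i j) lam_ge0) => -[hx ->]; lra.
Qed.

(** Expanding the square entrywise leaves a cross term that [clip_obtuse] makes nonnegative. The
    inequality yields both minimality and uniqueness of the projection. *)
Lemma Blam_proj_pythagoras (lam : R) X Y : 0 <= lam -> Blam lam Y ->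
  frob_norm (Blam_proj lam X - X) ^+ 2 + frob_norm (Y - Blam_proj lam X) ^+ 2
    <= frob_norm (Y - X) ^+ 2.
Proof.
move=> lam_ge0 [_ Y0 Yle]; rewrite !frob_norm_sqr !frob_dotE -big_split.
apply: ler_sum => i _; rewrite -big_split; apply: ler_sum => j _ /=; rewrite !mxE.
have [->|neq_ij] := eqVneq i j; first by rewrite Y0 mul0r; lra.
have := clip_obtuse (X i j) lam_ge0 (Yle i j neq_ij).
by rewrite mul1r; lra.
Qed.

Lemma prox_indicator_Blam (lam : R) X : 0 <= lam -> Sym X ->
  prox (indicator (Blam lam)) X = Blam_proj lam X.
Proof.
move=> lam_ge0 symX; have BP := Blam_proj_in lam_ge0 symX.
(* [prox] picks some minimizer, so its value is known only once the minimizer is shown to be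
   unique. *)
rewrite /prox; apply: xget_unique.
  split=> [|Y symY]; first by case: BP.
  rewrite /indicator; case: asboolP => // _; case: asboolP => BY; last first.
    by rewrite addye // leey.
  rewrite !add0e lee_fin ler_wpM2l ?invr_ge0 //.
  by apply: le_trans (Blam_proj_pythagoras X lam_ge0 BY); rewrite lerDl sqr_ge0.
move=> Y [symY minY]; have := minY _ (let: And3 symP _ _ := BP in symP).
rewrite /indicator; case: (asboolP (Blam lam (Blam_proj _ _))) => // _.
case: asboolP => BY; last by rewrite addye // add0e leye_eq.
rewrite !add0e lee_fin ler_pM2l ?invr_gt0 // => le_YP.
have := le_trans (Blam_proj_pythagoras X lam_ge0 BY) le_YP.
rewrite gerDl frob_norm_sqr => /frob_dot_eq0 /eqP.
by rewrite subr_eq0 => /eqP.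
Qed.

(** The tests [t = 1] and [t = -1] with the triangle inequality bound [z]; the test [t = - w] gives
    the other claim. *)
Lemma subgradient_abs_bounds (lam z w : R) : 0 <= lam ->
  (forall t, z * t <= lam * (`|w + t| - `|w|)) ->
  `|z| <= lam /\ lam * `|w| <= z * w.
Proof.
move=> lam_ge0 subg; split; last first.
  by have := subg (- w); rewrite subrr normr0; lra.
have bound t : lam * (`|w + t| - `|w|) <= lam * `|t|.
  by rewrite ler_wpM2l // lerBlDl ler_normD.
rewrite ler_norml; apply/andP; split.
  have := le_trans (subg (-1)) (bound (-1)); rewrite normrN1; lra.
by have := le_trans (subg 1) (bound 1); rewrite normr1; lra.
Qed.

(** With [z = d - eta], the hypotheses give [clip lam (w + z) = z]. The left-hand quantity is thus
    [d - (clip lam (w + z) - clip lam (w + z - d))], and since [clip] is nondecreasing and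
    1-Lipschitz, it lies between 0 and [d]. *)
Lemma clip_residual_le (lam eta d w : R) : 0 <= lam ->
  `|d - eta| <= lam -> lam * `|w| <= (d - eta) * w ->
  `|eta + clip lam (w - eta)| <= `|d|.
Proof.
move=> lam_ge0; rewrite ler_norml => /andP[z1 z2] zw.
(* The branches are [w < 0], [w > 0] and [w = 0], in this order. In the first two, [d - eta] sits at
   an endpoint of [[-lam, lam]]. *)
have [w0|w_gt0|w_lt0] := ltgtP w 0.
- have e : d - eta = - lam.
    by apply/eqP; rewrite eq_le z1 andbT; move: zw; rewrite ltr0_norm //; nra.
  by case: (clipP (w - eta) lam_ge0) => -[hx ->];
    case: (ger0P d) => hd; rewrite ler_norml; lra.
- have e : d - eta = lam.
    by apply/eqP; rewrite eq_le z2 /=; move: zw; rewrite gtr0_norm //; nra.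
  by case: (clipP (w - eta) lam_ge0) => -[hx ->];
    case: (ger0P d) => hd; rewrite ler_norml; lra.
- by case: (clipP (w - eta) lam_ge0) => -[hx ->];
    case: (ger0P d) => hd; rewrite ler_norml; lra.
Qed.

Lemma resid_argmin_le n (A : 'M[R]_(p, n)) lam Delta Om : 0 <= lam -> Sym Delta ->
  argmin Sym (objective A lam Delta) Om ->
  frob_norm (resid A lam Om) <= frob_norm Delta.
Proof.
move=> lam_ge0 symDelta minOm; have [symOm _] := minOm.
have symh := h_sym A symOm.
have symX : Sym (Om - h A Om) by rewrite /Sym /= linearB /= symOm symh.
have symZ : Sym (Delta - h A Om) by rewrite /Sym /= linearB /= symDelta symh.
have entry i j t := subgradient_entry i j t symZ symOm
  (fun Y => argmin_subgradient lam_ge0 symDelta minOm (Y := Y)).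
apply: le_frob_norm => i j; rewrite /resid prox_indicator_Blam //.
move: (entry i j).
move: (h A Om) => H; rewrite !mxE.
have [_ {}entry|neq_ij {}entry] := eqVneq i j.
  (* On the diagonal the projection is 0, and testing both signs of [t] forces the entries of [H]
     and [Delta] to agree. *)
  have := entry 1; have := entry (-1); rewrite !mul0r addr0 => e1 e2.
  by rewrite (_ : H i j = Delta i j) //; lra.
have [|z_le zw] := @subgradient_abs_bounds lam (Delta i j - H i j) (Om i j) lam_ge0.
  by move=> t; have := entry t; rewrite mul1r.
by rewrite mul1r; apply: clip_residual_le.
Qed.

End Projection.

(** Every terminating execution ends with the exit rule, whose guard is the bound; induction carries
    it back through the iterations. *)
Lemma as_loop_resid (R : realType) (p n : nat) (A : 'M[R]_(p, n)) eps lam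
    Om I Om' I' :
  as_loop A eps lam Om I Om' I' -> frob_norm (resid A lam Om') <= eps.
Proof. by elim=> // Om1 I1; rewrite -leNgt. Qed.

Theorem theorem6 (R : realType) (p n : nat) (A : 'M[R]_(p, n))
  (hA : \rank A = n) (eps : R) (heps : 0 <= eps)
  (k : nat) (lam : nat -> R)
  (lam_max : lam 0%N <= lambda_max A)
  (lam_decr : forall i, (i < k)%N -> lam i.+1 < lam i)
  (lam_gt0 : 0 < lam k)
  (Omega : nat -> 'M[R]_p)
  (hOmega : as_path A eps k lam Omega) :
  forall i, (i <= k)%N -> frob_norm (resid A (lam i) (Omega i)) <= eps.
Proof.
have lam_le i : (i <= k)%N -> lam i <= lam 0%N.
  elim: i => // i IHi lt_ik.
  exact: le_trans (ltW (lam_decr i lt_ik)) (IHi (ltnW lt_ik)).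
have lam0_ge0 : 0 <= lam 0%N by apply: le_trans (ltW lam_gt0) (lam_le k _).
case: hOmega => I [[[Delta [symDelta leDelta minOm]] _] loop] [_|i lt_ik].
  exact: le_trans (resid_argmin_le lam0_ge0 symDelta minOm) leDelta.
by have /as_loop_resid := loop i lt_ik.
Qed.
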